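(* Let $q\geq 7$ be a prime power. Then $$n(k,7)\leq \begin{cases} 2k^3-4k^2+2k, & \text{if } k=q+1,\\ 2k^3-2k, & \text{if } k=q.\end{cases}$$
   Context: Graphs are finite and simple. The girth of a graph is the length of its shortest cycle. A $(k,g)$-graph is a $k$-regular graph with girth (exactly) $g$. For $k\ge 2$ and $g\ge 3$, $n(k,g)$ denotes the minimum number of vertices of a $(k,g)$-graph (such graphs exist for all $k\geq 2$, $g\geq 3$ by a theorem of Erdős and Sachs). *)

(* Defs.v *)
From mathcomp Require Import all_boot.

Set Implicit Arguments.
Unset Strict Implicit.
Unset Printing Implicit Defensive.

Record sgraph := SGraph {
  vertex :> finType;
  adj : rel vertex;
  adj_sym : symmetric adj;
  adj_irr : irreflexive adj
}.

Definition degree (G : sgraph) (x : G) : nat := #|[set y | adj x y]|.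

Definition regular (G : sgraph) (k : nat) : Prop :=
  forall x : G, degree x = k.

(* The bound on the size is needed because [ucycle] also accepts the empty
   sequence and the sequence [:: x; y] traversing one edge back and forth. *)
Definition is_cycle (G : sgraph) (c : seq G) : Prop :=
  ucycle (@adj G) c /\ 3 <= size c.

(* An acyclic graph satisfies [has_girth G g] for no g. *)
Definition has_girth (G : sgraph) (g : nat) : Prop :=
  (exists2 c : seq G, is_cycle c & size c = g) /\
  (forall c : seq G, is_cycle c -> g <= size c).

Definition kg_graph (k g : nat) (G : sgraph) : Prop :=
  regular G k /\ has_girth G g.

(* [is_n k g m] says that n(k, g) is defined and equal to m. It is a relation
   rather than a function so that no junk value is involved: the existence of
   (k, g)-graphs is itself a theorem (Erdos and Sachs). *)
Definition is_n (k g m : nat) : Prop :=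
  (exists2 G : sgraph, kg_graph k g G & #|G| = m) /\
  (forall G : sgraph, kg_graph k g G -> m <= #|G|).

Definition prime_power (q : nat) : Prop :=
  exists p e : nat, [/\ prime p, 0 < e & q = p ^ e].

(* Main.v *)
(** Let [H] be a bipartite [k]-regular graph of girth 8. Remove a set [D] of
    vertices such that every other vertex loses at most one neighbour, its hub,
    and add a perfect matching between the survivors of each hub. Mated vertices
    were joined by a path of length 2 through their hub, so after the removal
    their distance is at least 6, and a cycle using one new edge has length at
    least 7. A shorter cycle needs two new edges: it is excluded if no two
    vertices with a hub are adjacent and if the matchings of two hubs never
    correspond to each other.

    For [k = q + 1], [H] is the incidence graph of the generalized quadrangle
    [T_2(O)]. In even characteristic the removed set consists of the lines
    through a point and the points of a line through it; here hubs on the same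
    side are collinear or concurrent, so their matchings never meet. In odd
    characteristic a set of [q] vertices has no perfect matching,
    and the removed set is instead a pair of noncollinear points with their common
    neighbours and the lines joining them. The remaining lines through each common
    neighbour are indexed by [F^*] in such a way that lines [s] and [r] with
    different hubs meet exactly when [r = - s], so the same matching [f] of [F^*]
    works for all hubs provided [f (- s) != - f s]; it exists because [q >= 7].

    For [k = q], the points of [H] are the matrices of [SL_2(q)] and its lines the
    equations [X (1, d)^T = w] with [w != 0]; it has [2 (q^3 - q)] vertices and one
    removes a vertex or an edge, according to the characteristic. *)

Require Import Defs.
From mathcomp Require Import all_boot.
From mathcomp Require Import all_algebra all_field.
From mathcomp Require Import ring zify.
From Stdlib Require Import Classical.

Set Implicit Arguments.
Unset Strict Implicit.
Unset Printing Implicit Defensive.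

(** Descent on the order: a (k, g)-graph either has minimum order or can be replaced by a smaller
    one. Excluded middle decides, as the existence of a smaller graph is a mere proposition. *)
Lemma is_n_exists (k g : nat) (G : sgraph) :
  kg_graph k g G -> exists2 m : nat, is_n k g m & m <= #|G|.
Proof.
have [n] := ubnP #|G|; elim: n G => // n IHn G ltGn kgG.
have [[G' kgG' ltG'] | minG] :=
    classic (exists2 G' : sgraph, kg_graph k g G' & #|G'| < #|G|).
  have [m nm le_m] := IHn G' (leq_trans ltG' ltGn) kgG'.
  by exists m => //; apply: leq_trans (ltnW ltG').
exists #|G| => //; split=> [|G' kgG']; first by exists G.
by rewrite leqNgt; apply/negP => ltG'; case: minG; exists G'.
Qed.

(** * Replacing removed vertices by matchings *)

(** Bipartiteness rules out odd cycles, so excluding cycles of length 4 and 6 gives girth at least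
    8. In [g8_no6] distinctness is asked within each side, the two sides being disjoint. *)
Record girth8_regular (T : finType) (H : rel T) (side : pred T) (k : nat) :
    Prop := Girth8Regular {
  g8_sym : symmetric H;
  g8_side : forall x y, H x y -> side y = ~~ side x;
  g8_degree : forall x, #|[set y | H x y]| = k;
  g8_no4 : forall x a y b,
    H x a -> H a y -> H y b -> H b x -> x = y \/ a = b;
  g8_no6 : forall x c y a z b,
    H x c -> H c y -> H y a -> H a z -> H z b -> H b x ->
    uniq [:: x; y; z] -> uniq [:: a; b; c] -> False
}.

Definition incidence_rel (P L : finType) (I : P -> L -> bool) : rel (P + L) :=
  fun x y => match x, y with
             | inl p, inr l | inr l, inl p => I p l
             | _, _ => false
             end.

Definition is_point (P L : Type) (x : P + L) : bool :=
  if x is inl _ then true else false.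

Lemma girth8_incidence (P L : finType) (I : P -> L -> bool) (k : nat) :
  (forall p, #|[set y | incidence_rel I (inl p) y]| = k) ->
  (forall l, #|[set y | incidence_rel I (inr l) y]| = k) ->
  (forall p p' l l', I p l -> I p l' -> I p' l -> I p' l' ->
     p = p' \/ l = l') ->
  (forall p p' p'' l l' l'', I p l'' -> I p' l'' -> I p' l -> I p'' l ->
     I p'' l' -> I p l' ->
     uniq [:: p; p'; p''] -> uniq [:: l; l'; l''] -> False) ->
  girth8_regular (incidence_rel I) (@is_point P L) k.
Proof.
move=> degP degL no4 no6; split.
- by case=> [p|l] [p'|l'].
- by case=> [p|l] [p'|l'].
- by case.
- case=> [p|l] [p'|l'] // [p''|l''] // [p3|l3] //= i1 i2 i3 i4.
    by case: (no4 p p'' l' l3) => // ->; [left | right].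
  by case: (no4 p' p3 l l'') => // ->; [right | left].
case=> [p|l] [p'|l'] // [p''|l''] // [p3|l3] // [p4|l4] // [p5|l5] //=.
  rewrite /= => i1 i2 i3 i4 i5 i6 U V.
  exact: (no6 p p'' p4 l3 l5 l' i1 i2 i3 i4 i5 i6 U V).
rewrite /= => i1 i2 i3 i4 i5 i6 U V.
(* A hexagon starting at a line is read from its second vertex on, which rotates both triples. *)
apply: (no6 p' p3 p5 l4 l l'') => //; first by rewrite -(rot_uniq 1).
by rewrite -(rot_uniq 1).
Qed.

(** [hubP] packs two facts: a survivor has at most one neighbour in [D], since every such neighbour
    equals the value of [hub], and [hub] is [None] exactly when there is none. *)
Record surgery (T : finType) (H : rel T) (D : {set T}) (hub : T -> option T)
    (mate : T -> T) : Prop := Surgery {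
  hubP : forall x, x \notin D -> forall z,
    (hub x == Some z) = (z \in D) && H x z;
  mate_notin : forall x, x \notin D -> hub x -> mate x \notin D;
  mate_neq : forall x, x \notin D -> hub x -> mate x != x;
  mateK : forall x, x \notin D -> hub x -> mate (mate x) = x;
  hub_mate : forall x, x \notin D -> hub x -> hub (mate x) = hub x;
  hub_adj : forall x a, x \notin D -> a \notin D -> H x a ->
    hub x -> hub a -> False;
  mate_conflict : forall x a c c', x \notin D -> a \notin D ->
    c \notin D -> c' \notin D -> hub x -> hub a -> hub x != hub a ->
    H x c -> H c a -> H (mate x) c' -> H c' (mate a) -> False
}.

(** * Regularity and girth of the graph after surgery *)

Section SurgeryGraph.

Variables (T : finType) (H : rel T) (side : pred T) (k : nat).
Variables (D : {set T}) (hub : T -> option T) (mate : T -> T).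
Hypotheses (H8 : girth8_regular H side k) (HD : surgery H D hub mate).

Let V := {x : T | x \notin D}.
Let mated (x y : V) : bool := hub (val x) && (mate (val x) == val y).
Definition surgery_adj (x y : V) : bool := H (val x) (val y) || mated x y.

Let mated_sym : symmetric mated.
Proof.
suff half x y : mated x y -> mated y x by move=> x y; apply/idP/idP; apply: half.
case/andP=> hx /eqP e; rewrite /mated -e; apply/andP; split.
  by rewrite (hub_mate HD) // (valP x).
by rewrite (mateK HD) // (valP x).
Qed.

Lemma surgery_adj_sym : symmetric surgery_adj.
Proof. by move=> x y; rewrite /surgery_adj (g8_sym H8) mated_sym. Qed.

Lemma surgery_adj_irr : irreflexive surgery_adj.
Proof.
move=> x; apply/negP => /orP[/(g8_side H8)|/andP[hx]]; first by case: (side _).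
exact/negP/(mate_neq HD (valP x) hx).
Qed.

Definition surgery_graph : sgraph := SGraph surgery_adj_sym surgery_adj_irr.

Lemma card_surgery_graph : #|surgery_graph| = #|T| - #|D|.
Proof.
by rewrite /= card_sig -(cardsC D) addKn -cardsE; apply: eq_card => x; rewrite !inE.
Qed.

(* Both vertices are adjacent in [H] to their common hub. *)
Let mated_side x y : mated x y -> side (val y) = side (val x).
Proof.
case/andP=> hx /eqP <-; case E: (hub (val x)) hx => [z|] // _.
have /eqP := E; rewrite (hubP HD (valP x)) => /andP[_ /(g8_side H8)].
have hx : hub (val x) by rewrite E.
have := hub_mate HD (valP x) hx; rewrite E => /eqP.
rewrite (hubP HD (mate_notin HD (valP x) hx)) => /andP[_ /(g8_side H8) ->].
by move/negb_inj.
Qed.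

(** A vertex with a hub loses the hub and gains its mate, which was not a neighbour because it lies
    on the same side. *)
Lemma surgery_regular : regular surgery_graph k.
Proof.
move=> x; rewrite /degree -(card_imset _ val_inj) -(g8_degree H8 (val x)).
set A := imset _ _; set B := [set y | H _ y].
have memA y : (y \in A) = (y \notin D) && (H (val x) y ||
    hub (val x) && (mate (val x) == y)).
  apply/imsetP/idP => [[y' + ->]|/andP[yD Hxy]].
    by rewrite inE /= => Hxy; rewrite (valP y').
  by exists (Sub y yD); rewrite ?inE ?SubK.
case E: (hub (val x)) => [z|]; last first.
  apply: eq_card => y; rewrite memA E /= orbF inE andbC.
  case Hxy: (H _ _) => //=; apply/negP => yD.
  by have := hubP HD (valP x) y; rewrite E Hxy yD.
have hx : hub (val x) by rewrite E.
have /andP[zD Hxz] : (z \in D) && H (val x) z by rewrite -(hubP HD (valP x)) E.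
have mxD := mate_notin HD (valP x) hx.
have nHm : ~~ H (val x) (mate (val x)).
  have Mxm : mated x (exist (fun t => t \notin D) _ mxD) by rewrite /mated hx /= eqxx.
  by apply/negP => /(g8_side H8); rewrite (mated_side Mxm); case: (side _).
have -> : A = mate (val x) |: B :\ z.
  apply/setP=> y; rewrite memA !inE hx /=.
  have [<-|neq_y] := eqVneq; first by rewrite mxD orbT.
  rewrite orbF; case Hxy: (H _ _); rewrite ?andbF //= !andbT.
  by rewrite -[y \in D]andbT -Hxy -(hubP HD (valP x)) E (eq_sym y).
rewrite cardsU1 !inE (negbTE nHm) andbF /= (cardsD1 z B) !inE Hxz.
by [].
Qed.

Let Hv (x y : V) : bool := H (val x) (val y).

Let Hv_side x y : Hv x y -> side (val y) = ~~ side (val x).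
Proof. exact: (g8_side H8). Qed.

Let mated_inj x y y' : mated x y -> mated x y' -> y = y'.
Proof. by case/andP=> _ /eqP e /andP[_ /eqP e']; apply: val_inj; rewrite -e. Qed.

Let mated_hub x y : mated x y ->
  exists z, [/\ hub (val x) = Some z, hub (val y) = Some z, z \in D,
    H (val x) z & H (val y) z].
Proof.
move=> Mxy; case/andP: (Mxy) => hx /eqP e; case E: (hub (val x)) hx => [z|] // _.
have hx : hub (val x) by rewrite E.
have Ey : hub (val y) = Some z by rewrite -e (hub_mate HD (valP x) hx).
have /eqP := E; rewrite (hubP HD (valP x)) => /andP[zD Hxz].
have /eqP := Ey; rewrite (hubP HD (valP y)) => /andP[_ Hyz].
by exists z.
Qed.

(* The lemma [no_w] excludes walks whose successive edges are mated ([M]) or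
   edges of [H] ([H]) as spelled by [w]. *)
Let no_MHH x y a : mated x y -> Hv y a -> Hv a x -> False.
Proof.
move=> Mxy Hya Hax; have [z [_ _ zD Hxz Hyz]] := mated_hub Mxy.
have Hzx : H z (val x) by rewrite (g8_sym H8).
case: (g8_no4 H8 Hya Hax Hxz _); first by rewrite (g8_sym H8).
  move/val_inj=> e; move: Mxy; rewrite e; case/andP=> hx.
  exact/negP/(mate_neq HD (valP x) hx).
by move=> e; case/negP: (valP a); rewrite e.
Qed.

(** Replacing the new edge by the path through the hub yields a hexagon of [H]. *)
Let no_MHHHH x y a c b : mated x y -> Hv y a -> Hv a c -> Hv c b -> Hv b x ->
  uniq [:: x; y; a; c; b] -> False.
Proof.
move=> Mxy Hya Hac Hcb Hbx U; have [z [_ _ zD Hxz Hyz]] := mated_hub Mxy.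
have zV (v : V) : val v != z by apply: contraTneq zD => <-; apply: (valP v).
apply: (g8_no6 H8 Hxz _ Hya Hac Hcb Hbx); first by rewrite (g8_sym H8).
  move: U; rewrite /= !inE !val_eqE; do ![case: (_ == _)] => //.
move: U; rewrite /= !inE !val_eqE (eq_sym a b) !negb_or !zV !andbT.
by rewrite eq_sym; do ![case: (_ == _)].
Qed.

Let no_MHM x y z w : mated x y -> Hv y z -> mated z w -> False.
Proof.
move=> /mated_hub[h [_ hy _ _ _]] Hyz /mated_hub[h' [hz _ _ _ _]].
by apply: (hub_adj HD (valP y) (valP z) Hyz); rewrite ?hy ?hz.
Qed.

(** If the hubs coincide in [h], then [y], [c], [z], [h] form a 4-cycle of [H]; otherwise this is
    [mate_conflict]. *)
Let no_MHHMHH x y c z w c' : mated x y -> Hv y c -> Hv c z -> mated z w ->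
  Hv w c' -> Hv c' x -> y != z -> False.
Proof.
move=> Mxy Hyc Hcz Mzw Hwc Hcx neq_yz.
have [h [hx hy hD Hxh Hyh]] := mated_hub Mxy.
have [h' [hz hw hD' Hzh Hwh]] := mated_hub Mzw.
have [e|neq_h] := eqVneq h h'.
  rewrite -e in Hzh; have Hhy : H h (val y) by rewrite (g8_sym H8).
  case: (g8_no4 H8 Hyc Hcz Hzh Hhy) => [/val_inj/eqP|e']; first exact/negP.
  by case/negP: (valP c); rewrite e'.
have Myx : mated y x by rewrite mated_sym.
case/andP: Myx => _ /eqP ey; case/andP: Mzw => _ /eqP ez.
apply: (mate_conflict HD (valP y) (valP z) (valP c) (valP c') _ _ _ Hyc Hcz).
- by rewrite hy.
- by rewrite hz.
- by rewrite hy hz; apply: contra_neq neq_h => -[].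
- by rewrite ey (g8_sym H8).
- by rewrite ez (g8_sym H8).
Qed.

Let no_MM x y z : mated x y -> mated y z -> x != z -> False.
Proof. by rewrite mated_sym => m1 m2; rewrite (mated_inj m1 m2) eqxx. Qed.

Let adj_cases x y : surgery_adj x y ->
  Hv x y /\ side (val y) = ~~ side (val x) \/
  mated x y /\ side (val y) = side (val x).
Proof.
by case/orP=> e; [left | right]; split=> //; [apply: Hv_side | apply: mated_side].
Qed.

Let no_HHHH x a y b : Hv x a -> Hv a y -> Hv y b -> Hv b x ->
  x != y -> a != b -> False.
Proof.
move=> h1 h2 h3 h4 /eqP n1 /eqP n2.
by case: (g8_no4 H8 h1 h2 h3 h4) => /val_inj.
Qed.

Let no_HHHHHH x c y a z b : Hv x c -> Hv c y -> Hv y a -> Hv a z -> Hv z b ->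
  Hv b x -> uniq [:: x; y; z] -> uniq [:: a; b; c] -> False.
Proof.
move=> h1 h2 h3 h4 h5 h6 U U'; apply: (g8_no6 H8 h1 h2 h3 h4 h5 h6).
  by rewrite -(map_inj_uniq val_inj) in U.
by rewrite -(map_inj_uniq val_inj) in U'.
Qed.

Ltac distinct := solve [ assumption | rewrite eq_sym; assumption |
  rewrite /= !inE !negb_or; do ?[apply/andP; split];
  first [ done | assumption | rewrite eq_sym; assumption ] ].

(** Matching may start at any vertex of the cycle, so each pattern covers all rotations of its
    word. *)
Ltac no_short_cycle := exfalso; match goal with
  | a : is_true (mated ?x ?y), b : is_true (mated ?y ?z) |- _ =>
      apply: (no_MM a b); distinct
  | a : is_true (mated ?x ?y), b : is_true (Hv ?y ?z),
    c : is_true (mated ?z ?w) |- _ => exact: (no_MHM a b c)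
  | m : is_true (mated ?x ?y), a : is_true (Hv ?y ?z),
    b : is_true (Hv ?z ?x) |- _ => exact: (no_MHH m a b)
  | m : is_true (mated ?x ?y), a : is_true (Hv ?y ?z), b : is_true (Hv ?z ?w),
    c : is_true (Hv ?w ?t), d : is_true (Hv ?t ?x) |- _ =>
      apply: (no_MHHHH m a b c d); distinct
  | m : is_true (mated ?x ?y), a : is_true (Hv ?y ?z), b : is_true (Hv ?z ?w),
    m' : is_true (mated ?w ?t), c : is_true (Hv ?t ?u),
    d : is_true (Hv ?u ?x) |- _ => apply: (no_MHHMHH m a b m' c d); distinct
  | a : is_true (Hv ?x ?y), b : is_true (Hv ?y ?z), c : is_true (Hv ?z ?w),
    d : is_true (Hv ?w ?x) |- _ => apply: (no_HHHH a b c d); distinct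
  | a : is_true (Hv ?x ?y), b : is_true (Hv ?y ?z), c : is_true (Hv ?z ?w),
    d : is_true (Hv ?w ?t), e : is_true (Hv ?t ?u), f : is_true (Hv ?u ?x)
    |- _ => apply: (no_HHHHHH a b c d e f); distinct
  end.

Ltac split_ands := repeat match goal with
  | h : is_true (_ && _) |- _ => case/andP: h => ? ? end.

(** Edges of [H] change sides and new edges do not, so a cycle has an even number of edges of [H].
    Up to rotation, such a word of length 3 to 6 contains MM or MHM, or is MHH, HHHH, MHHHH, HHHHHH
    or MHHMHH. *)
Lemma surgery_girth_ge (c : seq surgery_graph) : is_cycle c -> 7 <= size c.
Proof.
case=> /andP[cyc U] size_c; rewrite leqNgt; apply/negP => lt_c7; move: c cyc U size_c lt_c7.
case=> [|x1 [|x2 [|x3 c]]] //= /and3P[/adj_cases e1 /adj_cases e2].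
case: c => [|x4 [|x5 [|x6 [|x7 c]]]] //= cyc;
  rewrite !inE !negb_or ?andbT => U _ _.
- case/andP: cyc => /adj_cases e3 _; split_ands.
  case: e1 => -[h1 s1]; case: e2 => -[h2 s2]; case: e3 => -[h3];
    rewrite s2 s1 => s3; first [by case: (side _) s3 | no_short_cycle].
- case/and3P: cyc => /adj_cases e3 /adj_cases e4 _; split_ands.
  case: e1 => -[h1 s1]; case: e2 => -[h2 s2]; case: e3 => -[h3 s3]; case: e4 => -[h4];
    rewrite s3 s2 s1 => s4; first [by case: (side _) s4 | no_short_cycle].
- case/and4P: cyc => /adj_cases e3 /adj_cases e4 /adj_cases e5 _; split_ands.
  case: e1 => -[h1 s1]; case: e2 => -[h2 s2]; case: e3 => -[h3 s3]; case: e4 => -[h4 s4];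
    case: e5 => -[h5]; rewrite s4 s3 s2 s1 => s5;
    first [by case: (side _) s5 | no_short_cycle].
- case/and5P: cyc => /adj_cases e3 /adj_cases e4 /adj_cases e5 /adj_cases e6 _; split_ands.
  case: e1 => -[h1 s1]; case: e2 => -[h2 s2]; case: e3 => -[h3 s3]; case: e4 => -[h4 s4];
    case: e5 => -[h5 s5]; case: e6 => -[h6]; rewrite s5 s4 s3 s2 s1 => s6;
    first [by case: (side _) s6 | no_short_cycle].
Qed.

(** The girth is attained: a path of length 6 in [H] between mates, avoiding [D], is closed by the
    new edge. *)
Lemma surgery_kg (x : T) (s : seq T) :
  hub x -> last x s = mate x -> path H x s -> uniq (x :: s) -> size s = 6 ->
  all [predC D] (x :: s) -> kg_graph k 7 surgery_graph.
Proof.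
move=> hx last_s Hs U size_s notD; split; first exact: surgery_regular.
split; last exact: surgery_girth_ge.
have [c Ec] : exists c : seq V, map val c = x :: s.
  elim: (x :: s) notD => [|y t IHt] /=; first by exists [::].
  by case/andP=> yD /IHt[c <-]; exists (exist (fun z => z \notin D) y yD :: c).
have size_c : size c = 7 by rewrite -(size_map val) Ec /= size_s.
exists c => //; split; last by rewrite size_c.
apply/andP; split; last by rewrite -(map_inj_uniq val_inj) Ec.
pose e := [rel y z | H y z || hub y && (mate y == z)].
suff: cycle e (map val c) by rewrite cycle_map.
have xD : x \notin D by case/andP: notD.
rewrite Ec /= rcons_path last_s /= (hub_mate HD) // (mateK HD) // hx eqxx orbT andbT.
by apply: sub_path Hs => y z /= ->.
Qed.

End SurgeryGraph.

Arguments surgery_kg {T H side k D hub mate} H8 HD x s.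

Lemma card_nbrs (S T : finType) (H : rel T) (x : T) (f : S -> T) (g : T -> S) :
  cancel f g -> (forall s, H x (f s)) -> (forall y, H x y -> f (g y) = y) ->
  #|[set y | H x y]| = #|S|.
Proof.
move=> fK Hf gK; rewrite -(cardsT S) -(card_imset [set: S] (can_inj fK)).
apply: eq_card => y; rewrite inE; apply/idP/imsetP => [/gK <-|[s _ ->] //].
by exists (g y).
Qed.

(** * A matching of the units avoiding its opposite *)

Section Matching.

Import GRing.Theory.
Local Open Scope ring_scope.

Lemma oppr_neq (F : fieldType) (x : F) : 1 + 1 != 0 :> F -> x != 0 -> - x != x.
Proof.
move=> two_neq0 nx; rewrite eq_sym -addr_eq0 -mulr2n -mulr_natl mulf_eq0.
by rewrite negb_or nx andbT.
Qed.

Lemma next_next_neq (T : eqType) (c : seq T) (x : T) :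
  uniq c -> (2 < size c)%N -> x \in c -> next c (next c x) != x.
Proof.
move=> Uc lt2c /rot_to[i c' E]; rewrite -!(next_rot i Uc) E.
have : uniq (x :: c') by rewrite -E rot_uniq.
have : (2 < size (x :: c'))%N by rewrite -E size_rot.
case: c' {E} => [|a [|b c']] //= _; rewrite !inE !negb_or eqxx.
case/and3P => /and3P[xa xb _] _ _.
by rewrite (eq_sym a x) (negbTE xa) eqxx eq_sym.
Qed.

Lemma prev_neq_next (T : eqType) (c : seq T) (x : T) :
  uniq c -> (2 < size c)%N -> x \in c -> prev c x != next c x.
Proof.
move=> Uc lt2c xc; apply: contra_neq (next_next_neq Uc lt2c xc) => <-.
exact: next_prev.
Qed.

(* [A] contains exactly one of [x] and [- x] for each [x != 0], hence at least
   three elements. The matching sends [x] in [A] to the opposite of its successor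
   in the cyclic order on [A]; it differs from that of its predecessor. *)
Lemma sign_matching (F : finFieldType) : 1 + 1 != 0 :> F -> (7 <= #|F|)%N ->
  exists f : F -> F, forall x, x != 0 ->
    [/\ f x != 0, f (f x) = x, f x != x & f (- x) != - f x].
Proof.
move=> two_neq0 le7F.
(* Any total order on [F] selects one of [x] and [- x]; the rank in the enumeration serves. *)
pose P (x : F) := (x != 0) && (enum_rank x < enum_rank (- x))%N.
pose A := filter P (enum F).
have UA : uniq A by rewrite filter_uniq ?enum_uniq.
have memA x : (x \in A) = P x by rewrite mem_filter mem_enum andbT.
have AN x : x != 0 -> (- x \in A) = (x \notin A).
  move=> nx; rewrite !memA /P oppr_eq0 nx opprK /= -leqNgt ltn_neqAle.
  by rewrite val_eqE (inj_eq enum_rank_inj) oppr_neq.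
have A0 x : x \in A -> x != 0 by rewrite memA; case/andP.
have lt2A : (2 < size A)%N.
  suff : (#|F| <= 1 + (size A + size A))%N by lia.
  rewrite -{2}(size_map -%R A) -size_cat -[X in (_ <= X)%N]/(size (0 :: A ++ map -%R A)).
  apply: leq_trans (card_size _); rewrite subset_leq_card //; apply/subsetP=> x _.
  rewrite inE mem_cat; have [//|nx] := eqVneq x 0.
  case xA: (x \in A) => //=; apply/mapP; exists (- x); rewrite ?opprK //.
  by rewrite AN ?xA.
have nA x : x \in A -> - x \notin A by move=> xA; rewrite AN ?A0 // xA.
(* Outside [A] the formula inverts the first branch: if [x = - next A y], then
   [prev A (- x) = y]. *)
exists (fun x => if x \in A then - next A x else prev A (- x)) => x nx.
have [xA|xA] := boolP (x \in A).
  have nxA : next A x \in A by rewrite mem_next.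
  rewrite !(negbTE (nA _ _)) // !opprK oppr_eq0 A0 // prev_next //.
  split=> //; last exact: prev_neq_next.
  by apply: contraNneq (nA _ nxA) => ->.
have xA' : - x \in A by rewrite AN.
have pA : prev A (- x) \in A by rewrite mem_prev.
rewrite xA' pA A0 // next_prev // opprK; split=> //.
  by apply: contraNneq xA => <-.
by rewrite (inj_eq oppr_inj) eq_sym; apply: prev_neq_next.
Qed.

End Matching.

(** * The generalized quadrangle of a conic *)

Section Quadrangle.

Import GRing.Theory.
Local Open Scope ring_scope.

Variable F : finFieldType.

(** The projective line: [Some t] is spanned by (1, t) and [None] by (0, 1). *)
Definition dir := option F.
Implicit Types (d e f : dir) (w : F * F) (s : F).

Definition vx d : F := if d is Some _ then 1 else 0.
Definition vy d : F := if d is Some t then t else 1.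
Definition det d e : F := vx d * vy e - vy d * vx e.
Definition dot d w : F := vx d * w.1 + vy d * w.2.

(* The triple [(a, b, c)] stands for the symmetric matrix [[a, c], [c, b]]. *)
Definition sym2 := (F * F * F)%type.
Implicit Types Y : sym2.

Definition app Y d : F * F :=
  (Y.1.1 * vx d + Y.2 * vy d, Y.2 * vx d + Y.1.2 * vy d).

(* [s u u^T], where [u] spans the orthogonal of the direction [d]. *)
Definition rk1 d s : sym2 := (s * vy d ^+ 2, s * vx d ^+ 2, - (s * vx d * vy d)).

Definition bil e f Y : F := dot e (app Y f).

Lemma det_neq0 d e : d != e -> det d e != 0.
Proof.
case: d e => [t|] [t'|] //= ne; rewrite /det /=.
- by rewrite mul1r mulr1 subr_eq0; apply: contra_neq ne => ->.
- by rewrite mulr0 subr0 mulr1 oner_eq0.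
- by rewrite mul0r mulr1 sub0r oppr_eq0 oner_eq0.
Qed.

Lemma app_sub Y Y' d : app (Y - Y') d = app Y d - app Y' d.
Proof.
case: Y Y' => [[a b] c] [[a' b'] c'].
by congr pair; rewrite /=; ring.
Qed.

Lemma app_eq0 Y d : app Y d = 0 -> exists s, Y = rk1 d s.
Proof.
case: Y d => [[a b] c] [t|] []; rewrite /= ?(mulr1, mulr0, add0r) => e1 e2.
  have ec : c = - (b * t) by apply/eqP; rewrite -addr_eq0 e2.
  have ea : a = - (c * t) by apply/eqP; rewrite -addr_eq0 e1.
  by exists b; rewrite ea ec; congr (_, _, _); rewrite /=; ring.
by exists a; rewrite e1 e2; congr (_, _, _); rewrite /=; ring.
Qed.

Lemma rk1_0 d : rk1 d 0 = 0.
Proof. by congr (_, _, _); ring. Qed.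

Lemma app_rk1 d e s :
  app (rk1 d s) e = (- (s * det d e * vy d), s * det d e * vx d).
Proof. by congr pair; rewrite /det /=; ring. Qed.

Lemma bil_rk1 d e f s : bil e f (rk1 d s) = s * det d e * det d f.
Proof. by rewrite /bil app_rk1 /dot /det /=; ring. Qed.

Lemma bil_sub e f Y Y' : bil e f (Y - Y') = bil e f Y - bil e f Y'.
Proof. by rewrite /bil app_sub /dot /=; ring. Qed.

Lemma bilC e f Y : bil e f Y = bil f e Y.
Proof. by rewrite /bil /dot /=; ring. Qed.

Lemma rk1_bil_eq0 d e f s :
  d != e -> d != f -> bil e f (rk1 d s) = 0 -> s = 0.
Proof.
move=> /det_neq0 de /det_neq0 df /eqP.
by rewrite bil_rk1 !mulf_eq0 (negbTE de) (negbTE df) !orbF => /eqP.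
Qed.

(** The difference kills [d], so it is [rk1 d s]; its value s det(d, e)^2 at (e, e) vanishes. *)
Lemma app_inj2 Y Y' d e :
  d != e -> app Y d = app Y' d -> app Y e = app Y' e -> Y = Y'.
Proof.
move=> ne hd he; apply/eqP; rewrite -subr_eq0; apply/eqP.
have [|s E] := @app_eq0 (Y - Y') d; first by rewrite app_sub hd subrr.
rewrite E (@rk1_bil_eq0 d e e s) ?rk1_0 // -E bil_sub /bil he.
by rewrite subrr.
Qed.

(** The difference Y2 - Y3 is [rk1 d1 s]. By symmetry both Y2 and Y3 agree with Y1 as bilinear forms
    at (d2, d3), so s det(d1, d2) det(d1, d3) = 0. *)
Lemma sym2_no_triangle Y1 Y2 Y3 d1 d2 d3 : d1 != d2 -> d1 != d3 ->
  app Y2 d1 = app Y3 d1 -> app Y1 d2 = app Y3 d2 -> app Y1 d3 = app Y2 d3 ->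
  Y2 = Y3.
Proof.
move=> n12 n13 h1 h2 h3; apply/eqP; rewrite -subr_eq0; apply/eqP.
have [|s E] := @app_eq0 (Y2 - Y3) d1; first by rewrite app_sub h1 subrr.
rewrite E (@rk1_bil_eq0 d1 d2 d3 s) ?rk1_0 // -E bil_sub {1}/bil -h3 -/(bil _ _ _).
by rewrite bilC (bilC d2) /bil h2 subrr.
Qed.

Lemma sym2_no_plane_triangle Y Y' d e : d != e ->
  app Y e = app Y' e -> bil d d Y = bil d d Y' -> Y = Y'.
Proof.
move=> ne he hd; apply/eqP; rewrite -subr_eq0; apply/eqP.
have [|s E] := @app_eq0 (Y - Y') e; first by rewrite app_sub he subrr.
rewrite E (@rk1_bil_eq0 e d d s) ?rk1_0 1?eq_sym // -E bil_sub hd.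
by rewrite subrr.
Qed.

(* The quadrangle [T_2(O)] of the conic [O] of rank one symmetric matrices. Its
   points are the matrices [Y], the planes [v^T Y v = mu] tangent to [O] at
   [v^\perp], given by [(d, mu)], and one more point. Its lines are the affine
   lines [Y v = w], given by [(d, w)], and the points of [O]. *)
Definition gq_point := (sym2 + dir * F + unit)%type.
Definition gq_line := (dir * (F * F) + dir)%type.

Definition gq_inc (p : gq_point) (l : gq_line) : bool :=
  match p, l with
  | inl (inl Y), inl (d, w) => app Y d == w
  | inl (inr (d, mu)), inl (e, w) => (d == e) && (dot d w == mu)
  | inl (inr (d, mu)), inr e => d == e
  | inr _, inr _ => true
  | _, _ => false
  end.

Definition gq_vertex := (gq_point + gq_line)%type.
Definition mat_v Y : gq_vertex := inl (inl (inl Y)).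
Definition plane_v d s : gq_vertex := inl (inl (inr (d, s))).
Definition infty_v : gq_vertex := inl (inr tt).
Definition line_v d w : gq_vertex := inr (inl (d, w)).
Definition dir_v d : gq_vertex := inr (inr d).

Lemma vertex_eqE :
  (forall Y Y', (mat_v Y == mat_v Y') = (Y == Y')) *
  (forall d e s s', (plane_v d s == plane_v e s') = (d == e) && (s == s')) *
  (forall d e w w', (line_v d w == line_v e w') = (d == e) && (w == w')).
Proof. by []. Qed.

Definition gq_adj : rel gq_vertex := incidence_rel gq_inc.

(** Parametrizations of neighbourhoods for [card_nbrs]: [plane_line] solves [dot d w = mu] for [w],
    and [line_point] below solves [app Y d = w] for [Y]; each leaves one free coordinate [s]. *)
Definition plane_line d (mu s : F) : F * F :=
  if d is Some t then (mu - t * s, s) else (s, mu).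
Definition plane_coord d w : F := if d is Some _ then w.2 else w.1.

Definition line_point d w s : sym2 :=
  if d is Some t then (w.1 - (w.2 - s * t) * t, s, w.2 - s * t)
  else (s, w.2, w.1).
Definition line_coord d Y : F := if d is Some _ then Y.1.2 else Y.1.1.

Lemma gq_degree_point p : #|[set y | gq_adj (inl p) y]| = #|F|.+1.
Proof.
rewrite -card_option; case: p => [[Y|[d mu]]|[]].
- by apply: (@card_nbrs _ _ _ _ (fun d => line_v d (app Y d))
    (fun y => if y is inr (inl (d, _)) then d else None)) => [|d|[|[[d w]|]]] //= /eqP <-.
- apply: (@card_nbrs _ _ _ _
    (fun o => if o is Some s then line_v d (plane_line d mu s) else dir_v d)
    (fun y => if y is inr (inl (e, w)) then Some (plane_coord e w) else None)).
  + by case=> // s; case: d.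
  + by case=> [s|] //=; rewrite eqxx //=; case: d => [t|]; rewrite /dot /=; apply/eqP; ring.
  case=> [|[[e w]|e]] // => [/andP[/eqP <- /eqP <-]|/eqP <-] //=.
  by case: d w => [t|] [w1 w2]; congr (inr (inl (_, (_, _)))); rewrite /dot /=; ring.
by apply: (@card_nbrs _ _ _ _ dir_v (fun y => if y is inr (inr d) then d else None)) => // -[|[]].
Qed.

Lemma gq_degree_line l : #|[set y | gq_adj (inr l) y]| = #|F|.+1.
Proof.
rewrite -card_option; case: l => [[d w]|d].
  apply: (@card_nbrs _ _ _ _
    (fun o => if o is Some s then mat_v (line_point d w s) else plane_v d (dot d w))
    (fun y => if y is inl (inl (inl Y)) then Some (line_coord d Y) else None)).
  - by case=> // s; case: d.
  - case=> [s|] /=; last by rewrite !eqxx.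
    by apply/eqP; case: d w => [t|] [w1 w2]; congr pair; rewrite /=; ring.
  case=> [[[Y|[e mu]]|]|] //= => [/eqP <-|/andP[/eqP <- /eqP <-]] //.
  by case: d Y => [t|] [[a b] c]; congr (inl (inl (inl (_, _, _)))); rewrite /=; ring.
apply: (@card_nbrs _ _ _ _
    (fun o => if o is Some s then plane_v d s else infty_v)
    (fun y => if y is inl (inl (inr (_, mu))) then Some mu else None)).
- by case.
- by case=> [s|] //=.
by case=> [[[Y|[e mu]]|[]]|] //= /eqP ->.
Qed.

Ltac intro_eqs := repeat match goal with
  | |- is_true (_ && _) -> _ => case/andP
  | |- is_true (_ == _) -> _ => move/eqP=> ?
  | |- is_true true -> _ => move=> _
  end.

Lemma gq_no4 p p' l l' : gq_inc p l -> gq_inc p l' -> gq_inc p' l ->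
  gq_inc p' l' -> p = p' \/ l = l'.
Proof.
case: p p' l l' => [[Y|[d mu]]|[]] [[Y'|[d' mu']]|[]] [[e w]|e] [[e' w']|e'] //=;
  try by [intro_eqs; subst; auto; congruence].
move=> /eqP h1 /eqP h2 /eqP h3 /eqP h4; have [e_eq|ne] := eqVneq e e'.
  by right; rewrite -h1 -h2 e_eq.
by left; rewrite (@app_inj2 Y Y' e e') ?h1 ?h2 ?h3 ?h4.
Qed.

Lemma gq_no6 p p' p'' l l' l'' : gq_inc p l'' -> gq_inc p' l'' ->
  gq_inc p' l -> gq_inc p'' l -> gq_inc p'' l' -> gq_inc p l' ->
  uniq [:: p; p'; p''] -> uniq [:: l; l'; l''] -> False.
Proof.
have neq (T : eqType) (x y z : T) : uniq [:: x; y; z] -> [/\ x != y, y != z & x != z].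
  by rewrite /= !inE negb_or andbT => /andP[/andP[-> ->] ->].
move=> h1 h2 h3 h4 h5 h6 /neq[n1 n2 n3] /neq[m1 m2 m3]; move: h1 h2 h3 h4 h5 h6 n1 n2 n3 m1 m2 m3.
case: p p' p'' => [[Y|[d mu]]|[]] [[Y'|[d' mu']]|[]] [[Y''|[d'' mu'']]|[]] //=.
all: case: l l' l'' => [[e w]|e] [[e' w']|e'] [[e'' w'']|e''] //=.
all: try by [intro_eqs; subst; rewrite ?eqxx].
(* Triangles of three matrices remain, and of two matrices and a plane in each of three positions.
   Distinct lines through a matrix have distinct directions. *)
all: have dneq Z a a' : inl (a, app Z a) != inl (a', app Z a') :> gq_line -> a != a'
       by apply: contra_neq => ->.
- move=> /eqP a1 /eqP a2 /eqP a3 /eqP a4 /eqP a5 /eqP a6 _ n2 _ m1 _ m3.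
  case/eqP: n2; congr (inl (inl _)).
  apply: (@sym2_no_triangle Y Y' Y'' e e' e''); rewrite ?a1 ?a2 ?a3 ?a4 ?a5 ?a6 //.
    by apply: (dneq Y''); rewrite a4 a5.
  by apply: (dneq Y'); rewrite a3 a2.
- move=> /eqP a1 /eqP a2 /eqP a3 /andP[/eqP de /eqP a4] /andP[/eqP de' /eqP a5] /eqP a6 n1 _ _ _ _ m3.
  case/eqP: n1; congr (inl (inl _)); subst e e'.
  apply: (@sym2_no_plane_triangle _ _ d'' e''); rewrite /bil ?a1 ?a2 ?a3 ?a6 ?a4 ?a5 //.
  by apply: (dneq Y'); rewrite a3 a2.
- move=> /eqP a1 /andP[/eqP de'' /eqP a2] /andP[/eqP de /eqP a3] /eqP a4 /eqP a5 /eqP a6 _ _ n3 m1 _ _.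
  case/eqP: n3; congr (inl (inl _)); subst e'' e.
  apply: (@sym2_no_plane_triangle _ _ d' e'); rewrite /bil ?a1 ?a2 ?a3 ?a6 ?a4 ?a5 //.
  by apply: (dneq Y''); rewrite a4 a5.
move=> /andP[/eqP de'' /eqP a1] /eqP a2 /eqP a3 /eqP a4 /eqP a5 /andP[/eqP de' /eqP a6] _ n2 _ _ _ m3.
case/eqP: n2; congr (inl (inl _)); subst e'' e'.
apply: (@sym2_no_plane_triangle _ _ d e); rewrite /bil ?a1 ?a2 ?a3 ?a6 ?a4 ?a5 //.
  by rewrite eq_sym; apply: (dneq Y'); rewrite a3 a2.
by rewrite a1 a6.
Qed.

Lemma gq_girth8 :
  girth8_regular gq_adj (@is_point gq_point gq_line) #|F|.+1.
Proof.
exact: (girth8_incidence gq_degree_point gq_degree_line gq_no4 gq_no6).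
Qed.

Lemma card_gq_vertex :
  #|{: gq_vertex}| = (2 * #|F| ^ 3 + 2 * #|F| ^ 2 + 2 * #|F| + 2)%N.
Proof.
rewrite /gq_vertex /gq_point /gq_line /sym2 /dir.
rewrite !(card_sum, card_prod, card_option) card_unit.
set n := #|F|; rewrite -/n; ring.
Qed.

(* Characteristic 2: the lines through the point [infty_v] and the points of the
   line [dir_v None] are removed. *)
Definition flag_removed (x : gq_vertex) : bool :=
  match x with
  | inl (inl (inr (None, _))) | inl (inr _) | inr (inr _) => true
  | _ => false
  end.

Definition flag_hub (x : gq_vertex) : option gq_vertex :=
  match x with
  | inl (inl (inr (d, _))) => Some (dir_v d)
  | inr (inl (None, w)) => Some (plane_v None (dot None w))
  | _ => None
  end.

(** Adding 1 is a fixed-point-free involution in characteristic 2. For lines of direction [None] the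
    hub depends on [w.2], so [w.1] is shifted. *)
Definition flag_mate (x : gq_vertex) : gq_vertex :=
  match x with
  | inl (inl (inr (d, mu))) => plane_v d (mu + 1)
  | inr (inl (d, w)) => line_v d (w.1 + 1, w.2)
  | _ => x
  end.

Section CharTwo.

Hypothesis two0 : 1 + 1 = 0 :> F.

Lemma flag_surgery :
  surgery gq_adj [set x | flag_removed x] flag_hub flag_mate.
Proof.
have x11 (x : F) : x + 1 + 1 = x by rewrite -addrA two0 addr0.
split.
- move=> x; rewrite inE => nx z; rewrite inE; move: nx.
  case: x => [[[Y|[[t|] mu]]|[]]|[[[t|] w]|[t|]]] //= _;
  by case: z => [[[Y'|[[t'|] mu']]|[]]|[[[t'|] w']|[t'|]]] //=.
- by move=> [[[Y|[[t|] mu]]|[]]|[[[t|] w]|[t|]]]; rewrite !inE.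
- move=> [[[Y|[[t|] mu]]|[]]|[[[t|] w]|[t|]]]; rewrite !inE //= => _ _.
    by rewrite vertex_eqE eqxx /= -subr_eq0 addrAC subrr add0r oner_eq0.
  case: w => w1 w2; rewrite vertex_eqE xpair_eqE /=.
  by rewrite eqxx andbT -subr_eq0 addrAC subrr add0r oner_eq0.
- move=> [[[Y|[[t|] mu]]|[]]|[[[t|] [w1 w2]]|[t|]]]; rewrite !inE //= => _ _.
    by rewrite /plane_v x11.
  by rewrite /line_v /= x11.
- move=> [[[Y|[[t|] mu]]|[]]|[[[t|] [w1 w2]]|[t|]]]; rewrite !inE //= => _ _.
  by rewrite /dot /= !mul0r !add0r.
- move=> [[[Y|[[t|] mu]]|[]]|[[[t|] [w1 w2]]|[t|]]]; rewrite !inE //=;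
  by case=> [[[Y'|[[t'|] mu']]|[]]|[[[t'|] w']|[t'|]]] //=; rewrite !inE.
move=> [[[Y|[[t|] mu]]|[]]|[[[t|] [w1 w2]]|[t|]]]; rewrite !inE //=;
case=> [[[Y'|[[t'|] mu']]|[]]|[[[t'|] w']|[t'|]]] //=; rewrite !inE //=;
case=> [[[Y2|[[t2|] mu2]]|[]]|[[[t2|] w2']|[t2|]]] //=; rewrite !inE //=.
  move=> c' _ _ _ _ _ _ /eqP n /andP[/eqP e1 _] /andP[/eqP e2 _].
  by case: n; rewrite e1 e2.
by move=> c' _ _ _ _ _ _ /eqP n /eqP e1 /eqP e2; case: n; rewrite -e1 -e2.
Qed.

Lemma flag_kg : exists2 G : sgraph,
  kg_graph #|F|.+1 7 G & (#|G| <= 2 * #|F| ^ 3 + 2 * #|F| ^ 2)%N.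
Proof.
exists (surgery_graph gq_girth8 flag_surgery).
  apply: (surgery_kg _ _ (plane_v (Some 0) 0)
    [:: line_v (Some 0) (0, 0); mat_v (0, 0, 0); line_v None (0, 0); mat_v (1, 0, 0);
        line_v (Some 0) (1, 0); plane_v (Some 0) 1]) => //=.
  - by rewrite add0r.
  - rewrite /dot /app /= !(mul0r, mulr0, mulr1, mul1r, addr0, add0r) !eqxx //=.
  - by rewrite !inE !vertex_eqE !xpair_eqE !(eq_sym 0 1) !oner_eq0 /= !andbF.
  by rewrite !inE.
rewrite card_surgery_graph card_gq_vertex.
rewrite -addnA leq_subLR addnC leq_add2r.
(* An injection into the removed set bounds its size below by 2q + 2. *)
have <-: #|{: option F + option F}| = (2 * #|F| + 2)%N by rewrite card_sum !card_option; ring.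
pose f (o : option F + option F) : gq_vertex :=
  match o with
  | inl (Some mu) => plane_v None mu
  | inl None => infty_v
  | inr d => dir_v d
  end.
have f_inj : injective f by case=> [[?|]|?] [[?|]|?] //= [->].
rewrite -(card_imset _ f_inj) subset_leq_card //; apply/subsetP=> _ /imsetP[[[?|]|?] _ ->];
  by rewrite inE.
Qed.
End CharTwo.

(** The lines of direction [d] in the plane [(d, 0)] have [w] orthogonal to [d], so they are indexed
    by [s]; this is the indexing for which lines with different hubs meet only if their indices are
    opposite. *)
Definition perp d s : F * F := (- (s * vy d), s * vx d).
Definition perp_coord d w : F := if d is Some _ then w.2 else - w.1.

Lemma perpK d : cancel (perp d) (perp_coord d).
Proof. by case: d => [t|] s; rewrite /= ?mulr1 ?opprK. Qed.

Lemma perp0 d : perp d 0 = 0.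
Proof. by rewrite /perp !mul0r oppr0. Qed.

Lemma perp_eq0 d s : (perp d s == 0) = (s == 0).
Proof. by rewrite -(perp0 d) (inj_eq (can_inj (perpK d))). Qed.

Lemma dot_perp d e s : dot d (perp e s) = s * det e d.
Proof. by rewrite /dot /det /=; ring. Qed.

Lemma detC d e : det d e = - det e d.
Proof. by rewrite /det; ring. Qed.

Lemma detxx d : det d d = 0.
Proof. by rewrite /det; ring. Qed.

Lemma det_eq0 d e : (det d e == 0) = (d == e).
Proof.
by have [->|/det_neq0/negbTE] := eqVneq d e; first by rewrite detxx eqxx.
Qed.

Lemma dot_eq0 d w : dot d w = 0 -> w = perp d (perp_coord d w).
Proof.
case: w d => a b [t|]; rewrite /dot /perp /= ?(mul0r, mul1r, mulr1, mulr0, add0r).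
  by move/eqP; rewrite addr_eq0 mulrC => /eqP ->.
by move=> ->; rewrite opprK.
Qed.

Lemma app_rk1_perp d e s : app (rk1 d s) e = perp d (s * det d e).
Proof. exact: app_rk1. Qed.

Lemma rk1K d : cancel (rk1 d) (line_coord d).
Proof. by case: d => [t|] s; rewrite /= ?expr1n mulr1. Qed.

Lemma rk1_eq0 d s : (rk1 d s == 0) = (s == 0).
Proof. by rewrite -(rk1_0 d) (inj_eq (can_inj (rk1K d))). Qed.

Lemma app_rk1_eq0 d e s : s != 0 -> (app (rk1 d s) e == 0) = (d == e).
Proof.
by move=> ns; rewrite app_rk1_perp perp_eq0 mulf_eq0 (negbTE ns) det_eq0.
Qed.

(** A nonzero [Y] kills at most one direction, so the choice by [pick] is then determined. *)
Definition kernel Y : option dir := [pick d | app Y d == 0].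

Lemma kernel_rk1 d s : s != 0 -> kernel (rk1 d s) = Some d.
Proof.
move=> ns; rewrite /kernel; case: pickP => [e|/(_ d)]; rewrite app_rk1_eq0 ?eqxx //.
by move/eqP->.
Qed.

Lemma kernelP Y d : Y != 0 -> kernel Y = Some d ->
  exists2 s, s != 0 & Y = rk1 d s.
Proof.
rewrite /kernel => nY; case: pickP => // e /eqP/app_eq0[s EY] [<-].
by exists s => //; rewrite -(rk1_eq0 e) -EY.
Qed.

(* Odd characteristic: two noncollinear points, their common neighbours and the
   lines joining them are removed. *)
Definition trace_removed (x : gq_vertex) : bool :=
  match x with
  | inl (inl (inl Y)) => Y == 0
  | inl (inl (inr (_, mu))) => mu == 0
  | inr (inl (_, w)) => w == 0
  | _ => true
  end.

(** The noncollinear points are [mat_v 0] and [infty_v], and their common neighbours are the planes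
    [(d, 0)]. A nonzero singular matrix lies on the line [(d, 0)] of its kernel [d]. *)
Definition trace_hub (x : gq_vertex) : option gq_vertex :=
  match x with
  | inl (inl (inl Y)) => omap (fun d => line_v d 0) (kernel Y)
  | inl (inl (inr (d, _))) => Some (dir_v d)
  | inr (inl (d, w)) => if dot d w == 0 then Some (plane_v d 0) else None
  | _ => None
  end.

Section OddChar.

Hypothesis two_neq0 : 1 + 1 != 0 :> F.
Variable f : F -> F.
Hypothesis f_neq0 : forall s, s != 0 -> f s != 0.
Hypothesis fK : forall s, s != 0 -> f (f s) = s.
Hypothesis f_neq : forall s, s != 0 -> f s != s.
Hypothesis f_sign : forall s, s != 0 -> f (- s) != - f s.

(** Planes are matched by negation and rank one matrices by [f]: a conflict between the two would
    force f s = - s. *)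
Definition trace_mate (x : gq_vertex) : gq_vertex :=
  match x with
  | inl (inl (inl Y)) =>
      if kernel Y is Some d then mat_v (rk1 d (f (line_coord d Y))) else x
  | inl (inl (inr (d, mu))) => plane_v d (- mu)
  | inr (inl (d, w)) => line_v d (perp d (f (perp_coord d w)))
  | _ => x
  end.

Let rk1_v d s : gq_vertex := mat_v (rk1 d s).
Let perp_v d s : gq_vertex := line_v d (perp d s).

Variant deficient : gq_vertex -> Prop :=
  | DeficientMat d s of s != 0 : deficient (rk1_v d s)
  | DeficientPlane d s of s != 0 : deficient (plane_v d s)
  | DeficientLine d s of s != 0 : deficient (perp_v d s).

Lemma trace_deficient x : ~~ trace_removed x -> trace_hub x -> deficient x.
Proof.
case: x => [[[Y|[d mu]]|[]]|[[d w]|d]] //= nx.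
- case E: (kernel Y) => [d|] // _; have [s ns ->] := kernelP nx E.
  exact: DeficientMat.
- by move=> _; apply: DeficientPlane.
case: eqP => // /dot_eq0 E _; rewrite E; apply: DeficientLine.
by rewrite -(perp_eq0 d) -E.
Qed.

Lemma hub_rk1 d s : s != 0 -> trace_hub (rk1_v d s) = Some (line_v d 0).
Proof. by move=> ns; rewrite /= kernel_rk1. Qed.

Lemma mate_rk1 d s : s != 0 -> trace_mate (rk1_v d s) = rk1_v d (f s).
Proof. by move=> ns; rewrite /= kernel_rk1 // rk1K. Qed.

Lemma hub_perp d s : trace_hub (perp_v d s) = Some (plane_v d 0).
Proof. by rewrite /= dot_perp detxx mulr0 eqxx. Qed.

Lemma mate_perp d s : trace_mate (perp_v d s) = perp_v d (f s).
Proof. by rewrite /= perpK. Qed.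

(** If f s = - s, then applying [f] gives f (- s) = s = - f s, against [f_sign]. *)
Lemma f_neqN s : s != 0 -> f s != - s.
Proof.
by move=> ns; apply: contra_neq (f_sign ns) => fs; rewrite fs -{1}fs fK // opprK.
Qed.

Lemma gq_adj_sym : symmetric gq_adj.
Proof. exact: g8_sym gq_girth8. Qed.

Lemma mat_plane_path d s e mu c : c \notin [set x | trace_removed x] ->
  gq_adj (rk1_v d s) c -> gq_adj c (plane_v e mu) -> s * det d e ^+ 2 = mu.
Proof.
rewrite inE; case: c => [[[Y|[g r]]|[]]|[[g w]|g]] //= _ /eqP <-.
by case/andP => /eqP <- /eqP <-; rewrite -/(bil _ _ _) bil_rk1 expr2 mulrA.
Qed.

(** The two paths give s D^2 = mu and f(s) D^2 = - mu with D = det(d, e), hence f s = - s. *)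
Lemma mat_plane_conflict d s e mu c c' : s != 0 -> mu != 0 ->
  c \notin [set x | trace_removed x] -> c' \notin [set x | trace_removed x] ->
  gq_adj (rk1_v d s) c -> gq_adj c (plane_v e mu) ->
  gq_adj (rk1_v d (f s)) c' -> gq_adj c' (plane_v e (- mu)) -> False.
Proof.
move=> ns nmu cD c'D h1 h2 h3 h4.
have E := mat_plane_path cD h1 h2; have := mat_plane_path c'D h3 h4.
rewrite -E -mulNr => /mulIf; rewrite sqrf_eq0 => E'.
have := f_neqN ns; rewrite E' ?eqxx //.
by apply: contraNneq nmu => E0; rewrite -E E0 expr0n mulr0.
Qed.

(** Otherwise the two matrices would form a triangle with the zero matrix. *)
Lemma mat_mat_path d s e r c : s != 0 -> r != 0 -> d != e ->
  c \notin [set x | trace_removed x] ->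
  gq_adj (rk1_v d s) c -> gq_adj c (rk1_v e r) -> False.
Proof.
move=> ns nr ne; rewrite inE; case: c => [[[Y|[g mu]]|[]]|[[g w]|g]] //= _ /eqP <-.
rewrite !app_rk1_perp => /eqP E; have := congr1 (dot d) E; have := congr1 (dot e) E.
rewrite !dot_perp !detxx !mulr0 => /esym/eqP; rewrite !mulf_eq0 (negbTE ns) !det_eq0.
rewrite (negbTE ne) orbF => /eqP <- /eqP.
by rewrite !mulf_eq0 (negbTE nr) !det_eq0 eq_sym (negbTE ne).
Qed.

(** A common matrix Y has Y d = [perp d s] and Y e = [perp e r]; its symmetry gives r det(e, d) = s
    det(d, e). A plane contains lines of one direction only. *)
Lemma line_line_path d s e r c : d != e -> c \notin [set x | trace_removed x] ->
  gq_adj (perp_v d s) c -> gq_adj c (perp_v e r) -> r = - s.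
Proof.
move=> ne; rewrite inE; case: c => [[[Y|[g mu]]|[]]|[[g w]|g]] //= _.
  move=> /eqP h1 /eqP h2; have := bilC d e Y; rewrite /bil h1 h2 !dot_perp.
  by rewrite (detC e) mulrN -mulNr => /mulIf -/(_ (det_neq0 ne)) <-; rewrite opprK.
by case/andP=> /eqP h1 _ /andP[/eqP h2 _]; case/eqP: ne; congruence.
Qed.

Lemma plane_plane_path d s e r c : d != e -> c \notin [set x | trace_removed x] ->
  gq_adj (plane_v d s) c -> gq_adj c (plane_v e r) -> False.
Proof.
move=> ne; rewrite inE; case: c => [[[Y|[g mu]]|[]]|[[g w]|g]] //= _.
by case/andP=> /eqP h1 _ /andP[/eqP h2 _]; case/eqP: ne; congruence.
Qed.

Lemma trace_surgery :
  surgery gq_adj [set x | trace_removed x] trace_hub trace_mate.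
Proof.
split.
- move=> x; rewrite inE => nx z; rewrite inE; move: nx.
  case: x => [[[Y|[d mu]]|[]]|[[d w]|d]] //= nx.
  + case E: (kernel Y) => [d|] /=.
      have [s ns ->] := kernelP nx E.
      case: z => [[[Y'|[e r]]|[]]|[[e v]|e]]; rewrite ?andbF //=.
      rewrite (_ : (_ == _) = (line_v d 0 == line_v e v)) // vertex_eqE (eq_sym 0) andbC.
      by case: eqP => [->|//]; rewrite app_rk1_eq0.
    case: z => [[[Y'|[e r]]|[]]|[[e v]|e]]; rewrite ?andbF //=.
    have [->|//] := eqVneq v 0; move: E; rewrite /kernel.
    by case: pickP => // /(_ e) ->.
  + case: z => [[[Y'|[e r]]|[]]|[[e v]|e]]; rewrite ?andbF //=.
    have [->|//] := eqVneq v 0.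
    by rewrite -(perp0 d) dot_perp mul0r (eq_sym 0) (negbTE nx) !andbF; apply/eqP.
  rewrite (_ : (_ == _) = (dot d w == 0) && (plane_v d 0 == z)); last by case: ifP.
  case: z => [[[Y'|[e r]]|[]]|[[e v]|e]]; rewrite ?andbF //=.
    have [->|] //= := eqVneq Y' 0.
    by rewrite -(rk1_0 d) app_rk1_perp mul0r perp0 (eq_sym 0) (negbTE nx).
  rewrite (_ : (plane_v d 0 == _) = (d == e) && (0 == r)) // (eq_sym 0) (eq_sym e).
  case: (eqVneq r 0) => [->|]; rewrite ?andbF //= andbT andbC.
  by case: eqVneq => //= ->.
- move=> x; rewrite !inE => nx hx; case: (trace_deficient nx hx) => d s ns.
  + by rewrite mate_rk1 //= rk1_eq0 f_neq0.
  + by rewrite /= oppr_eq0.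
  by rewrite mate_perp /= perp_eq0 f_neq0.
- move=> x; rewrite !inE => nx hx; case: (trace_deficient nx hx) => d s ns.
  + by rewrite mate_rk1 // vertex_eqE (inj_eq (can_inj (rk1K d))) f_neq.
  + by rewrite vertex_eqE eqxx oppr_neq.
  by rewrite mate_perp vertex_eqE eqxx (inj_eq (can_inj (perpK d))) f_neq.
- move=> x; rewrite !inE => nx hx; case: (trace_deficient nx hx) => d s ns.
  + by rewrite !mate_rk1 ?f_neq0 // fK.
  + by rewrite /= /plane_v opprK.
  by rewrite !mate_perp fK.
- move=> x; rewrite !inE => nx hx; case: (trace_deficient nx hx) => d s ns.
  + by rewrite mate_rk1 // !hub_rk1 ?f_neq0.
  + by [].
  by rewrite mate_perp !hub_perp.
- move=> x a; rewrite !inE => nx na Hxa hx ha; move: Hxa.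
  have mat_line d s e r : s != 0 -> r != 0 -> ~~ (app (rk1 d s) e == perp e r).
    move=> ns nr; apply/eqP => E; have := congr1 (dot e) E.
    rewrite dot_perp detxx mulr0 -/(bil _ _ _) bil_rk1 => /eqP.
    rewrite !mulf_eq0 (negbTE ns) orbb det_eq0 => /eqP de.
    by move: E; rewrite de app_rk1_perp detxx mulr0 perp0 => /esym/eqP; rewrite perp_eq0 (negbTE nr).
  case: (trace_deficient nx hx) => d s ns; case: (trace_deficient na ha) => e r nr //=.
  + exact/negP/mat_line.
  + by rewrite dot_perp; case: eqP => [->|] //; rewrite detxx mulr0 eq_sym (negbTE ns).
  + exact/negP/mat_line.
  + by rewrite dot_perp; case: eqP => [->|] //; rewrite detxx mulr0 eq_sym (negbTE nr).
move=> x a c c'; rewrite 2!inE => nx na cD c'D hx ha.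
(* A path of length 2 preserves the side, so a line is only compared with a line. *)
have same_side : gq_adj x c -> gq_adj c a -> is_point a = is_point x.
  by move=> /(g8_side gq_girth8) h1 /(g8_side gq_girth8) ->; rewrite h1 negbK.
case: (trace_deficient nx hx) same_side => d s ns same_side;
  case: (trace_deficient na ha) same_side => e r nr same_side;
  rewrite ?mate_perp ?mate_rk1 ?hub_rk1 ?hub_perp // => nh h1 h2 h3 h4;
  try by have := same_side h1 h2.
- by apply: (mat_mat_path ns nr _ cD h1 h2); apply: contra_neq nh => ->.
- exact: (mat_plane_conflict ns nr cD c'D h1 h2 h3 h4).
- by apply: (mat_plane_conflict nr ns cD c'D); rewrite gq_adj_sym; eassumption.
- by apply: (plane_plane_path _ cD h1 h2); apply: contra_neq nh => ->.
have de : d != e by apply: contra_neq nh => ->.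
(* The two paths give r = - s and f r = - f s, which [f_sign] excludes. *)
have := line_line_path de cD h1 h2; have := line_line_path de c'D h3 h4.
by move=> E1 E2; have := f_sign ns; rewrite -E2 E1 eqxx.
Qed.

Lemma trace_surgery_kg : exists2 G : sgraph,
  kg_graph #|F|.+1 7 G & (#|G| <= 2 * #|F| ^ 3 + 2 * #|F| ^ 2)%N.
Proof.
have neqN1 : (1 == -1 :> F) = false by rewrite -addr_eq0 (negbTE two_neq0).
exists (surgery_graph gq_girth8 trace_surgery).
  apply: (surgery_kg _ _ (plane_v (Some 0) 1)
    [:: line_v (Some 0) (1, 0); mat_v (1, 1, 0); line_v None (0, 1);
        mat_v (-1, 1, 0); line_v (Some 0) (-1, 0); plane_v (Some 0) (-1)]) => //=.
  - rewrite /dot /app /= !(mul0r, mulr0, mulr1, mul1r, addr0, add0r) !eqxx //=.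
  - by rewrite !inE !vertex_eqE !xpair_eqE neqN1 /= !andbF.
  by rewrite !inE /= !xpair_eqE ?oppr_eq0 ?oner_eq0 ?andbF.
rewrite card_surgery_graph card_gq_vertex.
rewrite -addnA leq_subLR addnC leq_add2r.
(* The removed lines alone number 2q + 2. *)
have <-: #|{: option F + option F}| = (2 * #|F| + 2)%N by rewrite card_sum !card_option; ring.
pose g (o : option F + option F) : gq_vertex :=
  match o with inl d => line_v d 0 | inr d => dir_v d end.
have g_inj : injective g by case=> [?|?] [?|?] //= [->].
rewrite -(card_imset _ g_inj) subset_leq_card //; apply/subsetP=> _ /imsetP[[?|?] _ ->];
  by rewrite inE /= ?eqxx.
Qed.

End OddChar.

End Quadrangle.

(** * Matrices of determinant 1 *)

Section SL2.

Import GRing.Theory.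
Local Open Scope ring_scope.

Variable F : finFieldType.
Implicit Types (d e : F) (w : F * F).

(* The pair of pairs [((a, b), (c, d))] stands for the matrix [[a, b], [c, d]]. *)
Definition mat2 := ((F * F) * (F * F))%type.
Definition det2 (X : mat2) : F := X.1.1 * X.2.2 - X.1.2 * X.2.1.
Definition sl2 := {X : mat2 | det2 X == 1}.
Definition nzvec := {w : F * F | w != 0}.

(** A matrix satisfies q + 1 equations X v = w up to scaling of v; leaving out v = (0, 1) gives
    degree q on both sides. *)
Definition act (X : mat2) d : F * F := (X.1.1 + X.1.2 * d, X.2.1 + X.2.2 * d).

Definition sl2_line := (F * nzvec)%type.
Definition sl2_inc (X : sl2) (l : sl2_line) : bool := act (val X) l.1 == val l.2.
Definition sl2_vertex := (sl2 + sl2_line)%type.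
Definition sl2_adj : rel sl2_vertex := incidence_rel sl2_inc.

Lemma act_neq0 (X : sl2) d : act (val X) d != 0.
Proof.
case: X => [[[a b] [c e]] /= detX]; apply/eqP => -[/eqP].
rewrite addr_eq0 => /eqP ea /eqP; rewrite addr_eq0 => /eqP ec; case/eqP: (oner_neq0 F).
by rewrite -(eqP detX) /det2 /= ea ec; ring.
Qed.

Definition act_line (X : sl2) d : sl2_line := (d, Sub (act (val X) d) (act_neq0 X d)).

(** The second column (b, e) solves w.1 e - w.2 b = 1, with free parameter [s]; the first column is
    then w - d (b, e). *)
Definition line_mat (d : F) w s : mat2 :=
  let: (b, e) := if w.1 == 0 then (- w.2^-1, s) else (s, (1 + w.2 * s) / w.1) in
  ((w.1 - b * d, b), (w.2 - e * d, e)).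

Definition mat_coord w (X : mat2) : F := if w.1 == 0 then X.2.2 else X.1.2.

Lemma det_line_mat d w s : w != 0 -> det2 (line_mat d w s) == 1.
Proof.
case: w => [w1 w2]; rewrite xpair_eqE /line_mat /det2 /=.
have [-> /= nw|nw _] := eqVneq w1 0; apply/eqP; rewrite /=; first by field.
by field.
Qed.

Lemma act_line_mat d w s : act (line_mat d w s) d = w.
Proof.
by case: w => [w1 w2]; rewrite /act /line_mat /=; case: ifP => _ /=; congr pair; ring.
Qed.

Lemma line_matK d w : cancel (line_mat d w) (mat_coord w).
Proof. by case: w => w1 w2 s; rewrite /line_mat /mat_coord /=; case: (w1 == 0). Qed.

Lemma mat_coordK d w X : w != 0 -> det2 X == 1 -> act X d = w ->
  line_mat d w (mat_coord w X) = X.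
Proof.
case: X w => [[a b] [c e]] [w1 w2]; rewrite /det2 /act /= => nw /eqP detX [e1 e2].
have Ea : a = w1 - b * d by rewrite -e1 addrK.
have Ec : c = w2 - e * d by rewrite -e2 addrK.
move: detX nw; rewrite Ea Ec /line_mat /mat_coord xpair_eqE /=.
have [-> /= E nw|nw E _] := eqVneq w1 0.
  have -> : b = - w2^-1; last by [].
  apply: (mulfI nw); rewrite mulrN mulfV // -E; ring.
have -> : e = (1 + w2 * b) / w1; last by [].
by apply: (mulfI nw); rewrite mulrCA mulfV // mulr1 -E; ring.
Qed.

Lemma sl2_degree_point X : #|[set y | sl2_adj (inl X) y]| = #|F|.
Proof.
apply: (@card_nbrs _ _ _ _ (fun d => inr (act_line X d))
  (fun y => if y is inr l then l.1 else 0)) => [//|d|[//|[d w]]] /=.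
  by rewrite /sl2_inc /= eqxx.
by move=> /eqP E; congr (inr (_, _)); apply: val_inj.
Qed.

Lemma sl2_degree_line l : #|[set y | sl2_adj (inr l) y]| = #|F|.
Proof.
case: l => d w.
apply: (@card_nbrs _ _ _ _
  (fun s => inl (Sub (line_mat d (val w) s) (det_line_mat d s (valP w))))
  (fun y => if y is inl X then mat_coord (val w) (val X) else 0)) => [s|s|[X|//]] /=.
- exact: line_matK.
- by rewrite /sl2_inc /= act_line_mat.
move=> /eqP E; congr inl; apply: val_inj => /=.
by apply: mat_coordK E; [apply: (valP w) | apply: (valP X)].
Qed.

Lemma act_inj2 (X X' : mat2) d e :
  d != e -> act X d = act X' d -> act X e = act X' e -> X = X'.
Proof.
have aff (a b a' b' : F) : d != e -> a + b * d = a' + b' * d ->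
    a + b * e = a' + b' * e -> a = a' /\ b = b'.
  move=> ne h1 h2; have nde : d - e != 0 by rewrite subr_eq0.
  have Eb : b = b'.
    apply: (mulIf nde); rewrite !mulrBr.
    have -> : b * d - b * e = (a + b * d) - (a + b * e) by ring.
    by rewrite h1 h2; ring.
  by split=> //; move: h1; rewrite Eb => /addIr.
case: X X' => [[a b] [c g]] [[a' b'] [c' g']] ne [h1 h2] [h3 h4].
by have [-> ->] := aff _ _ _ _ ne h1 h3; have [-> ->] := aff _ _ _ _ ne h2 h4.
Qed.

Lemma act_diff (X X' : mat2) d : act X d = act X' d ->
  exists p : F * F, X' = ((X.1.1 - d * p.1, X.1.2 + p.1), (X.2.1 - d * p.2, X.2.2 + p.2)).
Proof.
case: X X' => [[a b] [c g]] [[a' b'] [c' g']] [h1 h2].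
exists (b' - b, g' - g); rewrite /=.
have -> : a' = a + b * d - b' * d by rewrite h1 addrK.
have -> : c' = c + g * d - g' * d by rewrite h2 addrK.
by congr (_, _, (_, _)); ring.
Qed.

(* The three matrices differ by rank one matrices: [X2 - X1 = p (-d3, 1)] and
   [X3 - X1 = r (-d2, 1)], with [r] a nonzero multiple of [p]. The linear parts
   of the determinants of [X2] and [X3] then force [p] to vanish. *)
Lemma sl2_no_triangle (X1 X2 X3 : mat2) d1 d2 d3 :
  det2 X1 = 1 -> det2 X2 = 1 -> det2 X3 = 1 ->
  d1 != d2 -> d2 != d3 -> d1 != d3 ->
  act X2 d1 = act X3 d1 -> act X1 d2 = act X3 d2 -> act X1 d3 = act X2 d3 ->
  X1 = X2.
Proof.
move=> D1 D2 D3 n12 n23 n13 h1 h2 h3.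
have [[p p'] E2] := act_diff h3; have [[r r'] E3] := act_diff h2.
move: D1 D2 D3 h1; rewrite {h2 h3}E2 {}E3 /act /det2 /=.
case: X1 => [[a b] [c g]] /= D1 D2 D3 [h1 h2].
have n12' : d1 - d2 != 0 by rewrite subr_eq0.
have n13' : d1 - d3 != 0 by rewrite subr_eq0.
have n23' : d3 - d2 != 0 by rewrite subr_eq0 eq_sym.
have Er : r * (d1 - d2) = p * (d1 - d3).
  have -> : r * (d1 - d2) = a - d2 * r + (b + r) * d1 - (a + b * d1) by ring.
  by rewrite -h1; ring.
have Er' : r' * (d1 - d2) = p' * (d1 - d3).
  have -> : r' * (d1 - d2) = c - d2 * r' + (g + r') * d1 - (c + g * d1) by ring.
  by rewrite -h2; ring.
(* The quadratic term of det X2 vanishes because X2 - X1 has rank one; this is the linear term. *)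
have K2 : p' * (a + b * d3) - p * (c + g * d3) = 0.
  by rewrite -(subrr 1) -{1}D2 -D1; ring.
have K3 : p' * (a + b * d2) - p * (c + g * d2) = 0.
  apply: (mulIf n13'); rewrite mul0r.
  have -> : (p' * (a + b * d2) - p * (c + g * d2)) * (d1 - d3) =
    p' * (d1 - d3) * (a + b * d2) - p * (d1 - d3) * (c + g * d2) by ring.
  rewrite -Er -Er'.
  have -> : r' * (d1 - d2) * (a + b * d2) - r * (d1 - d2) * (c + g * d2) =
    (r' * (a + b * d2) - r * (c + g * d2)) * (d1 - d2) by ring.
  suff -> : r' * (a + b * d2) - r * (c + g * d2) = 0 by rewrite mul0r.
  by rewrite -(subrr 1) -{1}D3 -D1; ring.
have Kb : p' * b = p * g.
  apply/eqP; rewrite -subr_eq0; apply/eqP; apply: (mulIf n23'); rewrite mul0r.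
  by rewrite -(subrr 0) -{1}K2 -K3; ring.
have Ka : p' * a = p * c.
  apply/eqP; rewrite -subr_eq0 -K2; apply/eqP.
  have -> : p' * (a + b * d3) - p * (c + g * d3) =
    p' * a - p * c + (p' * b - p * g) * d3 by ring.
  by rewrite Kb subrr mul0r addr0.
(* The vector (p, p') is parallel to both columns of the invertible matrix X1. *)
have -> : p = 0.
  rewrite -[p]mulr1 -D1.
  have -> : p * (a * g - b * c) = a * (p * g) - b * (p * c) by ring.
  by rewrite -Kb -Ka; ring.
have -> : p' = 0.
  rewrite -[p']mulr1 -D1.
  have -> : p' * (a * g - b * c) = g * (p' * a) - c * (p' * b) by ring.
  by rewrite Kb Ka; ring.
by rewrite !mulr0 !subr0 !addr0.
Qed.

Lemma sl2_no4 X X' l l' : sl2_inc X l -> sl2_inc X l' -> sl2_inc X' l ->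
  sl2_inc X' l' -> X = X' \/ l = l'.
Proof.
case: l l' => [d w] [e w'] /eqP /= h1 /eqP /= h2 /eqP /= h3 /eqP /= h4.
have [ne|ne] := eqVneq d e.
  by right; rewrite -ne in h2 *; congr pair; apply: val_inj; rewrite /= -h1 -h2.
by left; apply: val_inj; apply: (act_inj2 ne); rewrite ?h1 ?h2.
Qed.

Lemma sl2_no6 X X' X'' l l' l'' : sl2_inc X l'' -> sl2_inc X' l'' ->
  sl2_inc X' l -> sl2_inc X'' l -> sl2_inc X'' l' -> sl2_inc X l' ->
  uniq [:: X; X'; X''] -> uniq [:: l; l'; l''] -> False.
Proof.
case: l l' l'' => [d w] [d' w'] [d'' w''].
move=> /eqP /= h1 /eqP /= h2 /eqP /= h3 /eqP /= h4 /eqP /= h5 /eqP /= h6.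
rewrite /= !inE !negb_or !andbT => /andP[/andP[n1 _] _] /andP[/andP[m1 m3] m2].
have dneq (Z : sl2) (a a' : F) (v v' : nzvec) : act (val Z) a = val v -> act (val Z) a' = val v' ->
    (a, v) != (a', v') -> a != a'.
  by move=> ea ea'; apply: contra_neq => e; subst a'; congr pair; apply: val_inj; rewrite /= -ea -ea'.
case/eqP: n1; apply: val_inj.
apply: (@sl2_no_triangle _ _ (val X'') d d' d''); rewrite ?h1 ?h2 ?h3 ?h4 ?h5 ?h6 //.
- exact: eqP (valP X).
- exact: eqP (valP X').
- exact: eqP (valP X'').
- exact: (dneq _ _ _ _ _ h4 h5).
- exact: (dneq _ _ _ _ _ h6 h1).
- exact: (dneq _ _ _ _ _ h3 h2).
Qed.

Lemma sl2_girth8 : girth8_regular sl2_adj (@is_point sl2 sl2_line) #|F|.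
Proof.
exact: (girth8_incidence sl2_degree_point sl2_degree_line sl2_no4 sl2_no6).
Qed.

(** A matrix is determined by its first column, which is nonzero, and one free coordinate, so there
    are at most (q^2 - 1) q matrices; the lines number exactly that. *)
Lemma card_sl2_vertex : (#|{: sl2_vertex}| <= 2 * #|F| ^ 3 - 2 * #|F|)%N.
Proof.
have card_nz : #|{: nzvec}| = (#|F| * #|F|).-1.
  by rewrite card_sig -card_prod -(cardC1 (0 : F * F)); apply: eq_card.
have sl2_nz : (#|{: sl2}| <= #|{: nzvec * F}|)%N.
  apply: (leq_card (fun X : sl2 => ((act_line X 0).2, mat_coord (act (val X) 0) (val X)))).
  move=> X X' E; have /= e1 := congr1 (fun z => val z.1) E.
  have /= e2 := congr1 snd E; apply: val_inj.
  rewrite -(@mat_coordK 0 _ (val X) (act_neq0 X 0)) ?(eqP (valP X)) //.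
  rewrite -(@mat_coordK 0 _ (val X') (act_neq0 X' 0)) ?(eqP (valP X')) //.
  by rewrite e2 /= e1.
rewrite /sl2_vertex card_sum (leq_trans (leq_add sl2_nz (leqnn _))) //.
rewrite /sl2_line !card_prod card_nz (mulnC #|F| _.-1) addnn -mul2n -mulnBr leq_mul2l /=.
by rewrite -subn1 mulnBl mul1n !expnSr expn0 mul1n.
Qed.

Definition sl2_1 : sl2.
Proof. by exists ((1, 0), (0, 1)); rewrite /det2 /= mul0r subr0 mulr1. Defined.

Lemma act_1 d : act (val sl2_1) d = (1, d).
Proof. by rewrite /act /= mul0r mul1r addr0 add0r. Qed.

Lemma inc_one_line X d : sl2_inc X (act_line sl2_1 d) = (act (val X) d == (1, d)).
Proof. by rewrite -act_1. Qed.

Definition unip (s : F) : sl2.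
Proof. by exists ((1, s), (0, 1)); rewrite /det2 /= mulr0 subr0 mulr1. Defined.

Lemma sl2_vertex_eqE :
  (forall X X' : sl2, (inl X == inl X' :> sl2_vertex) = (val X == val X')) *
  (forall X X' d e, (inr (act_line X d) == inr (act_line X' e) :> sl2_vertex) =
     (d == e) && (act (val X) d == act (val X') e)).
Proof. by []. Qed.

Definition one_v : sl2_vertex := inl sl2_1.
Definition one_line d : sl2_vertex := inr (act_line sl2_1 d).
Definition unip_v s : sl2_vertex := inl (unip s).

Lemma one_lineP d (w : nzvec) : val w = (1, d) -> inr (d, w) = one_line d.
Proof. by move=> E; congr (inr (d, _)); apply: val_inj; rewrite E; exact/esym/act_1. Qed.

(* Characteristic 2: the identity matrix is removed. *)
Definition sl2_point_hub (x : sl2_vertex) : option sl2_vertex :=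
  if x is inr (d, w) then if val w == (1, d) then Some one_v else None else None.

(** The neighbours of the identity are indexed by all of [F], and adding 1 pairs them in
    characteristic 2. *)
Definition sl2_point_mate (x : sl2_vertex) : sl2_vertex :=
  if x is inr (d, _) then one_line (d + 1) else x.

Lemma hub_one_line d : sl2_point_hub (one_line d) = Some one_v.
Proof. by rewrite /= -[_ == _]/(act _ _ == _) act_1 eqxx. Qed.

Lemma sl2_point_deficient x : sl2_point_hub x -> exists d, x = one_line d.
Proof.
by case: x => [X|[d w]] //=; case: eqP => // /one_lineP E _; exists d.
Qed.

Lemma sl2_point_surgery : 1 + 1 = 0 :> F ->
  surgery sl2_adj [set one_v] sl2_point_hub sl2_point_mate.
Proof.
move=> two0; split.
- move=> x; rewrite inE => nx z; rewrite inE.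
  case: x nx => [X|[d w]] nx /=; case: (eqVneq z one_v) => [->|nz] //=; rewrite ?andbF //.
    by rewrite /sl2_inc act_1 (eq_sym (1, d)); case: ifP => _; rewrite ?eqxx.
  by case: ifP => // _; apply/eqP => -[E]; rewrite E eqxx in nz.
- by move=> x _ /sl2_point_deficient[d ->]; rewrite inE.
- move=> x _ /sl2_point_deficient[d ->] /=; apply/eqP => -[/eqP].
  by rewrite -subr_eq0 addrAC subrr add0r oner_eq0.
- by move=> x _ /sl2_point_deficient[d ->] /=; rewrite -addrA two0 addr0.
- by move=> x _ /sl2_point_deficient[d ->]; rewrite !hub_one_line.
- move=> x a _ _ Hxa /sl2_point_deficient[d Ex] /sl2_point_deficient[e Ea].
  by rewrite Ex Ea in Hxa.
by move=> x a c c' _ _ _ _ /sl2_point_deficient[d ->] /sl2_point_deficient[e ->]; rewrite !hub_one_line eqxx.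
Qed.

Definition mk_sl2 (X : mat2) (D : det2 X == 1) : sl2 := Sub X D.

Lemma sl2_point_surgery_kg : 1 + 1 = 0 :> F -> (2 < #|F|)%N ->
  exists2 G : sgraph, kg_graph #|F| 7 G & (#|G| <= 2 * #|F| ^ 3 - 2 * #|F|)%N.
Proof.
move=> two0 lt2F; exists (surgery_graph sl2_girth8 (sl2_point_surgery two0)); last first.
  by rewrite card_surgery_graph (leq_trans (leq_subr _ _)) ?card_sl2_vertex.
have [r nr0 nr1] : exists2 r : F, r != 0 & r != 1.
  case: (pickP (fun r : F => (r != 0) && (r != 1))) => [r /andP[? ?]|no]; first by exists r.
  suff : (#|F| <= 2)%N by rewrite leqNgt lt2F.
  apply: leq_trans (card_size [:: 0 : F; 1]); apply/subset_leq_card/subsetP => r _.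
  by have := no r; rewrite !inE; case: (r == 0); case: (r == 1).
have D1 : det2 ((1, 1), (0, 1)) == 1 by apply/eqP; rewrite /det2 /=; ring.
have D2 : det2 ((2 - r, r - 1), (1 - r, r)) == 1 by apply/eqP; rewrite /det2 /=; ring.
have D3 : det2 ((3 - 2 * r, 2 * r - 1), (1 - r, r)) == 1 by apply/eqP; rewrite /det2 /=; ring.
pose X1 := mk_sl2 D1; pose X2 := mk_sl2 D2; pose X3 := mk_sl2 D3.
(* [X2] and [X3] agree at [t], with common value (1/r, 0). *)
pose t : F := 1 - r^-1.
have r1 : (1 - r == 0) = false by rewrite subr_eq0 eq_sym (negbTE nr1).
have t0 : (t == 0) = false by rewrite subr_eq0 eq_sym invr_eq1 (negbTE nr1).
have t1 : (t == 1) = false.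
  by rewrite -subr_eq0 addrAC subrr add0r oppr_eq0 invr_eq0 (negbTE nr0).
have e23 : (3 - 2 * r == 2 - r) = false.
  by rewrite -subr_eq0 -r1; congr (_ == 0); ring.
apply: (surgery_kg _ _ (one_line 0)
  [:: inl X1; inr (act_line X1 1); inl X3; inr (act_line X3 t); inl X2; one_line 1]) => //.
- by rewrite hub_one_line.
- by rewrite /= add0r.
- rewrite /= /sl2_inc /= !eqxx /=.
  by apply/and5P; split=> //; apply/eqP; rewrite /act /t; congr pair; rewrite /=; field.
- rewrite /= !inE !sl2_vertex_eqE /= !xpair_eqE !(eq_sym 0) (eq_sym 1 t) r1 t0 t1 e23.
  by rewrite eqxx !oner_eq0 /= !andbF !mulr1 (inj_eq (addrI 1)) oner_eq0.
by rewrite /= !inE !sl2_vertex_eqE !xpair_eqE r1 !eqxx !oner_eq0 /= !andbF.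
Qed.

(* Odd characteristic: an incident pair, the identity matrix and the line of the
   matrices [unip s], is removed. *)
Definition sl2_flag_hub (x : sl2_vertex) : option sl2_vertex :=
  match x with
  | inl X => if act (val X) 0 == (1, 0) then Some (one_line 0) else None
  | inr (d, w) => if val w == (1, d) then Some one_v else None
  end.

(** Each removed vertex keeps q - 1 neighbours, indexed by the units, which negation pairs in odd
    characteristic. *)
Definition sl2_flag_mate (x : sl2_vertex) : sl2_vertex :=
  match x with
  | inl X => unip_v (- (val X).1.2)
  | inr (d, _) => one_line (- d)
  end.

Variant sl2_flag_deficient : sl2_vertex -> Prop :=
  | SL2FlagPoint s of s != 0 : sl2_flag_deficient (unip_v s)
  | SL2FlagLine d of d != 0 : sl2_flag_deficient (one_line d).

Lemma act_unip s d : act (val (unip s)) d = (1 + s * d, d).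
Proof. by rewrite /act /= add0r mul1r. Qed.

Lemma unipP (X : sl2) : act (val X) 0 = (1, 0) -> X = unip (val X).1.2.
Proof.
case: X => [[[a b] [c e]] D] [] /=; rewrite !mulr0 !addr0 => ea ec.
apply: val_inj; rewrite /= ea ec; congr (_, (_, _)).
by move: D; rewrite ea ec /det2 /= mulr0 subr0 mul1r => /eqP.
Qed.

Lemma unip_eq0 s : (unip_v s == one_v) = (s == 0).
Proof. by rewrite sl2_vertex_eqE !xpair_eqE !eqxx !andbT. Qed.

Lemma one_line_eq d e : (one_line d == one_line e) = (d == e).
Proof.
by rewrite sl2_vertex_eqE !act_1 xpair_eqE eqxx /= andbb.
Qed.

Lemma sl2_flag_deficientP x : x \notin [set one_v; one_line 0] -> sl2_flag_hub x ->
  sl2_flag_deficient x.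
Proof.
rewrite !inE negb_or => /andP[]; case: x => [X|[d w]] nx nl; rewrite /sl2_flag_hub.
  case: eqP => // /unipP E _; move: nx; rewrite E -/(unip_v _) unip_eq0.
  exact: SL2FlagPoint.
case: eqP => // /one_lineP E _; move: nl; rewrite E one_line_eq.
exact: SL2FlagLine.
Qed.

Lemma hub_unip s : sl2_flag_hub (unip_v s) = Some (one_line 0).
Proof. by rewrite /sl2_flag_hub /unip_v act_unip mulr0 addr0 eqxx. Qed.

Lemma sl2_flag_hub_one_line d : sl2_flag_hub (one_line d) = Some one_v.
Proof. by rewrite /= -[_ == _]/(act _ _ == _) act_1 eqxx. Qed.

Section OddChar.

Hypothesis two_neq0 : 1 + 1 != 0 :> F.

Lemma sl2_flag_surgery :
  surgery sl2_adj [set one_v; one_line 0] sl2_flag_hub sl2_flag_mate.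
Proof.
split.
- move=> x; rewrite !inE negb_or => /andP[nx nl] z; rewrite !inE.
  case: x nx nl => [X|[d w]] nx nl /=.
    case: (eqVneq z one_v) => [->|nz] /=; first by case: ifP.
    case: (eqVneq z (one_line 0)) => [->|nz'] //=.
      by rewrite inc_one_line; case: ifP; rewrite ?eqxx.
    by case: ifP => // _; apply/eqP => -[E]; rewrite E eqxx in nz'.
  case: (eqVneq z one_v) => [->|nz] /=.
    by rewrite /sl2_inc act_1 (eq_sym (1, d)); case: ifP => _; rewrite ?eqxx.
  case: (eqVneq z (one_line 0)) => [->|nz'] /=; first by case: ifP.
  by case: ifP => // _; apply/eqP => -[E]; rewrite E eqxx in nz.
- move=> x xD /(sl2_flag_deficientP xD)[s ns|d nd]; rewrite !inE /=.
    by rewrite -/(unip_v _) unip_eq0 oppr_eq0 (negbTE ns).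
  by rewrite one_line_eq oppr_eq0 (negbTE nd).
- move=> x xD /(sl2_flag_deficientP xD)[s ns|d nd] /=.
    by rewrite sl2_vertex_eqE !xpair_eqE (negbTE (oppr_neq two_neq0 ns)) ?andbF.
  by rewrite one_line_eq oppr_neq.
- move=> x xD /(sl2_flag_deficientP xD)[s ns|d nd] /=.
    by rewrite opprK.
  by rewrite opprK.
- move=> x xD /(sl2_flag_deficientP xD)[s ns|d nd].
    by rewrite !hub_unip.
  by rewrite !sl2_flag_hub_one_line.
(* Adjacent vertices with hubs would close a 4-cycle with the removed edge; in coordinates, s d =
   0. *)
- have no s d : s != 0 -> d != 0 -> sl2_inc (unip s) (act_line sl2_1 d) -> False.
    move=> ns nd; rewrite inc_one_line act_unip xpair_eqE eqxx andbT.
    by rewrite -subr_eq0 addrAC subrr add0r mulf_eq0 (negbTE ns) (negbTE nd).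
  move=> x a xD aD Hxa /(sl2_flag_deficientP xD) Dx /(sl2_flag_deficientP aD) Da.
  by case: Dx Hxa => [s ns|d nd]; case: Da => [s' ns'|d' nd'] //; apply: no.
move=> x a c c' xD aD _ _ hx ha nh h1 h2 _ _.
(* Here [x] and [a] lie on the same side, and each side has a single hub. *)
have := g8_side sl2_girth8 h2; rewrite (g8_side sl2_girth8 h1) negbK.
case: (sl2_flag_deficientP xD hx) nh => [s ns|d nd];
  case: (sl2_flag_deficientP aD ha) => [s' ns'|d' nd'] //;
  by rewrite ?hub_unip ?sl2_flag_hub_one_line eqxx.
Qed.

Lemma sl2_flag_surgery_kg : exists2 G : sgraph,
  kg_graph #|F| 7 G & (#|G| <= 2 * #|F| ^ 3 - 2 * #|F|)%N.
Proof.
exists (surgery_graph sl2_girth8 sl2_flag_surgery); last first.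
  by rewrite card_surgery_graph (leq_trans (leq_subr _ _)) ?card_sl2_vertex.
(* Integer matrices serve all odd q at once: the inequalities [n1] to [n4] reduce to 1 != 0 and 2 !=
   0. *)
have D1 : det2 ((2, -1), (1, 0)) == 1 by apply/eqP; rewrite /det2 /=; ring.
have D2 : det2 ((2, 1), (-1, 0)) == 1 by apply/eqP; rewrite /det2 /=; ring.
have D3 : det2 ((5, 2), (2, 1)) == 1 by apply/eqP; rewrite /det2 /=; ring.
pose X1 := mk_sl2 D1; pose X2 := mk_sl2 D2; pose X3 := mk_sl2 D3.
have n1 : (1 == -1 :> F) = false by rewrite -addr_eq0 (negbTE two_neq0).
have n2 : (1 == 2 :> F) = false.
  by rewrite eq_sym -subr_eq0 -(oner_eq0 F); congr (_ == 0); ring.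
have n3 : (1 == -3 :> F) = false.
  rewrite -addr_eq0 (_ : 1 + 3 = (1 + 1) * (1 + 1)); last by ring.
  by rewrite mulf_eq0 (negbTE two_neq0).
have n4 : (-1 == -3 :> F) = false.
  by rewrite -subr_eq0 -(negbTE two_neq0); congr (_ == 0); ring.
apply: (surgery_kg _ _ (one_line 1)
  [:: inl X1; inr (act_line X1 (-1)); inl X3; inr (act_line X3 (-3)); inl X2; one_line (-1)]) => //.
- by rewrite sl2_flag_hub_one_line.
- rewrite /= /sl2_inc /= !eqxx /=.
  by apply/and5P; split=> //; apply/eqP; rewrite /act; congr pair; rewrite /=; ring.
- have k1 : (1 + 0 * -1 == 0 + 1 * -1 :> F) = false.
    by rewrite mul0r addr0 add0r mul1r n1.
  rewrite /= !inE !sl2_vertex_eqE /= !xpair_eqE /= n1 n2 n3 n4 k1 (eq_sym (-3)) n4.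
  by rewrite !oner_eq0 /= !andbF.
have k2 : (2 == 0 :> F) = false by rewrite -(negbTE two_neq0).
have k3 : (2 + 1 * -3 == 0 + 1 * 0 :> F) = false.
  by rewrite -(oner_eq0 F) -oppr_eq0; congr (_ == _); ring.
by rewrite /= !inE !sl2_vertex_eqE !xpair_eqE /= k2 k3 !oppr_eq0 !oner_eq0 /= !andbF.
Qed.

End OddChar.

End SL2.

Theorem theorem8 (q k : nat) (hq : 7 <= q) (hpp : prime_power q) :
  (k = q + 1 ->
     exists2 m : nat, is_n k 7 m & m <= 2 * k ^ 3 - 4 * k ^ 2 + 2 * k) /\
  (k = q ->
     exists2 m : nat, is_n k 7 m & m <= 2 * k ^ 3 - 2 * k).
Proof.
have [p [e [p_pr e_gt0 q_eq]]] := hpp.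
have [F _ cardF] := PrimePowerField p_pr e_gt0.
have {}cardF : #|F| = q by rewrite cardF.
have le7F : 7 <= #|F| by rewrite cardF.
have bound (K N M : nat) : (exists2 G : sgraph, kg_graph K 7 G & #|G| <= N) ->
    N <= M -> exists2 m : nat, is_n K 7 m & m <= M.
  move=> [G /is_n_exists[m nm le_m] le_N] le_M; exists m => //.
  exact: leq_trans le_m (leq_trans le_N le_M).
split=> [->|->]; rewrite -cardF.
  have [G kgG leG] : exists2 G : sgraph,
      kg_graph #|F|.+1 7 G & #|G| <= 2 * #|F| ^ 3 + 2 * #|F| ^ 2.
    have [two0|two_neq0] := eqVneq (1 + 1 : F)%R 0%R; first exact: flag_kg.
    have [f fP] := sign_matching two_neq0 le7F.
    by apply: (@trace_surgery_kg F two_neq0 f) => s /fP[].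
  rewrite addn1; apply: bound; first by exists G; [exact: kgG | exact: leG].
  set n := #|F|.
  (* For k = q + 1 the bound equals 2 q^3 + 2 q^2; the identity is stated without truncated
     subtraction. *)
  have E : 2 * n.+1 ^ 3 + 2 * n.+1 = 2 * n ^ 3 + 2 * n ^ 2 + 4 * n.+1 ^ 2 by ring.
  lia.
apply: bound; last exact: leqnn.
have [two0|two_neq0] := eqVneq (1 + 1 : F)%R 0%R; last exact: sl2_flag_surgery_kg.
by apply: sl2_point_surgery_kg; rewrite // (leq_trans _ le7F).
Qed.
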